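(* Let $\mathcal{X}\subset\mathbb{R}^n$ be compact and regular closed, i.e. $\mathcal{X}=\overline{\mathrm{int}\,\mathcal{X}}$, let $f\in C^1(\mathcal{X})$ be real-valued (so $\overline{\nabla}f$ extends continuously to $\mathcal{X}$), and let $\rho:\mathcal{X}\to[0,\infty)$ be a probability density, $\int_{\mathcal{X}}\rho(x)\,dx=1$, with full support, $\mathrm{supp}\,\rho=\mathcal{X}$. Let $$C=\int_{\mathcal{X}}\overline{\nabla}f(x)\,\overline{\nabla}f(x)^{\top}\rho(x)\,dx=W\Lambda W^{\top},$$ with $W=[\boldsymbol{w}_1\,\cdots\,\boldsymbol{w}_n]$ orthogonal and $\Lambda=\mathrm{diag}(\lambda_1,\dots,\lambda_n)$, $\lambda_1\ge\dots\ge\lambda_n\ge 0$. Let $1\le r\le n$ and write $\mathcal{S}=\mathrm{span}\{\boldsymbol{w}_{r+1},\dots,\boldsymbol{w}_n\}$ for the trailing eigenspace of $C$. The following are equivalent: (i) $\lambda_i=0$ for all $i=r+1,\dots,n$; (ii) $df_x[\boldsymbol{v}]=0$ for every $x\in\mathcal{X}$ and every $\boldsymbol{v}\in\mathcal{S}$; (iii) $f(x+\boldsymbol{v})=f(x)$ for every $x\in\mathcal{X}$ and every $\boldsymbol{v}\in\mathcal{S}$ with $\{x+t\boldsymbol{v}:t\in[0,1]\}\subseteq\mathcal{X}$.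
   Context: $\overline{\nabla}f=(\partial f/\partial x^1,\dots,\partial f/\partial x^n)^{\top}$ is the Euclidean gradient, and $df_x[\boldsymbol{v}]=\boldsymbol{v}^{\top}\overline{\nabla}f(x)$ is the directional derivative of $f$ at $x$ along $\boldsymbol{v}$. Here $f\in C^1(\mathcal{X})$ means that $f$ is the restriction to $\mathcal{X}$ of a $C^1$ function on an open neighborhood of $\mathcal{X}$ in $\mathbb{R}^n$; since $\mathcal{X}$ is regular closed, $\overline{\nabla}f$ on $\mathcal{X}$ is determined by $f$. Full support means that every nonempty relatively open subset of $\mathcal{X}$ has positive measure under $\rho(x)\,dx$. If $r=n$, then $\mathcal{S}=\{0\}$. *)

(* Defs.v *)
From HB Require Import structures.
From mathcomp Require Import all_boot all_order all_algebra.
From mathcomp Require Import all_classical all_reals all_analysis.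

Set Implicit Arguments.
Unset Strict Implicit.
Unset Printing Implicit Defensive.

Import Order.TTheory GRing.Theory Num.Theory.
Import numFieldNormedType.Exports.

Local Open Scope classical_set_scope.
Local Open Scope ring_scope.

Section lebesgue_outer.
Context (R : realType) (n : nat).
Implicit Types (A : set 'cV[R]_n) (c : option ('cV[R]_n * 'cV[R]_n)).

(* [Some (a, b)] encodes the half-open box ]a_1, b_1] x ... x ]a_n, b_n];
   [None] encodes the empty set, so that a cover may be finite or empty (when
   n = 0 no box is empty). *)
Definition box c : set 'cV[R]_n :=
  if c is Some (a, b) then
    [set x : 'cV[R]_n | forall i, a i ord0 < x i ord0 <= b i ord0]
  else set0.

Definition box_volume c : R :=
  if c is Some (a, b) then \prod_i Num.max 0 (b i ord0 - a i ord0) else 0.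

Definition box_cover A : set (nat -> option ('cV[R]_n * 'cV[R]_n)) :=
  [set c | A `<=` \bigcup_k box (c k)].

Local Open Scope ereal_scope.

Definition lebesgue_outer A : \bar R :=
  ereal_inf [set \sum_(k <oo) (box_volume (c k))%:E | c in box_cover A].

Let volume_ge0 c : 0 <= (box_volume c)%:E.
Proof.
case: c => [[a b]|] /=; rewrite lee_fin ?lexx//.
by apply: prodr_ge0 => i _; rewrite le_max lexx.
Qed.

Let lebesgue_outer_ge0 A : 0 <= lebesgue_outer A.
Proof.
by apply: le_ereal_inf_tmp => _ [c _ <-]; exact: nneseries_ge0.
Qed.

Let lebesgue_outer0 : lebesgue_outer set0 = 0.
Proof.
apply/eqP; rewrite eq_le lebesgue_outer_ge0 andbT.
by apply: ereal_inf_lbound; exists (fun=> None) => //; rewrite eseries0.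
Qed.

Let le_lebesgue_outer : {homo lebesgue_outer : A B / A `<=` B >-> A <= B}.
Proof.
move=> A B AB; apply: ereal_inf_le_tmp => _ [c Bc <-].
by exists c => //; exact: subset_trans Bc.
Qed.

Let lebesgue_outer_sigma_subadditive : sigma_subadditive lebesgue_outer.
Proof.
move=> A; have [[i ioo]|] := pselect (exists i, lebesgue_outer (A i) = +oo).
  rewrite (eseries_pinfty _ _ ioo) ?leey// => k _.
  by rewrite -ltNye (lt_le_trans _ (lebesgue_outer_ge0 _)).
rewrite -forallNE => Aoo.
suff add2e (e : {posnum R}) : lebesgue_outer (\bigcup_k A k) <=
    \sum_(i <oo) lebesgue_outer (A i) + e%:num%:E.
  by apply/lee_addgt0Pr => _/posnumP[].
rewrite (le_trans _ (epsilon_trick _ _ _))//.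
pose v c := (box_volume c)%:E.
pose P i (c : nat -> _) := box_cover (A i) c /\
  \sum_(k <oo) v (c k) <= lebesgue_outer (A i) + (e%:num / (2 ^ i.+1)%:R)%:E.
have [G PG] : {G & forall i, P i (G i)}.
  apply: (@choice _ _ P) => i.
  have en1 : (0 < e%:num / (2 ^ i.+1)%:R)%R by [].
  have : lebesgue_outer (A i) \is a fin_num.
    by rewrite ge0_fin_numE// ltey; apply/eqP/Aoo.
  move=> /(lb_ereal_inf_adherent en1)[_ [c Ac <-] /ltW lec].
  by exists c.
have vG_ge0 x : 0 <= (v \o uncurry G) x by exact: volume_ge0.
apply: (@le_trans _ _ (\esum_(i in setT) (v \o uncurry G) i)).
  apply: ereal_inf_lbound => /=.
  have /card_esym/ppcard_eqP[f] := card_nat2.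
  exists (uncurry G \o f).
    move=> t [i _ /(PG i).1[j _ Gijt]]; exists (f^-1%FUN (i, j)) => //=.
    by rewrite invK ?inE.
  rewrite -(esum_pred_image (v \o uncurry G) _ xpredT) ?[fun=> _]set_true//.
  by rewrite image_eq.
rewrite (_ : esum _ _ = \sum_(i <oo) \sum_(j <oo) v (G i j)); last first.
  pose J : nat -> set (nat * nat) := fun i => [set (i, j) | j in setT].
  rewrite (_ : setT = \bigcup_k J k); last first.
    by rewrite predeqE => -[i j]; split => // _; exists i => //; exists j.
  rewrite esum_bigcupT /=; last 2 first.
    - apply/trivIsetP => i j _ _ ij.
      rewrite predeqE => -[k m] /=; split => //= -[] [_] _ [<-{k} _].
      by move=> [m' _] [] /esym/eqP; rewrite (negbTE ij).
    - by move=> [k m]; exact: volume_ge0.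
  rewrite -(image_id [set: nat]) -fun_true esum_pred_image//; last first.
    by move=> k _; apply: esum_ge0 => m _; exact: volume_ge0.
  apply: eq_eseriesr => /= j _.
  rewrite -(esum_pred_image (v \o uncurry G) (pair j) predT)//=; last first.
    by move=> ? ? _ _; exact: (@can_inj _ _ _ snd).
    by move=> m _; exact: volume_ge0.
  by congr esum; rewrite predeqE => -[i k]; split; move=> [m _ <-]; exists m.
apply: lee_lim.
- apply: is_cvg_nneseries => i *.
  by apply: nneseries_ge0 => m *; exact: (vG_ge0 (i, m)).
- by apply: is_cvg_nneseries => i *; apply: adde_ge0.
- by near=> k; apply: lee_sum => i _; exact: (PG i).2.
Unshelve. all: by end_near. Qed.

HB.instance Definition _ := isOuterMeasure.Build R 'cV[R]_n lebesgue_outer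
  lebesgue_outer0 lebesgue_outer_ge0 le_lebesgue_outer
  lebesgue_outer_sigma_subadditive.

End lebesgue_outer.

(* R^n with the sigma-algebra of Lebesgue (not only Borel) measurable sets, and
   the Lebesgue measure on it. *)
Definition lebesgueType (R : realType) (n : nat) : measurableType _ :=
  caratheodory_type (@lebesgue_outer R n).

Definition lebesgue_cV (R : realType) (n : nat) :
    {measure set (lebesgueType R n) -> \bar R} :=
  (@lebesgue_outer R n : {outer_measure set 'cV[R]_n -> \bar R}).

Section gradient.
Context (R : realType) (n : nat).
Implicit Types (X U : set 'cV[R]_n) (f g : 'cV[R]_n -> R).

Definition regular_closed X := X = closure X°.

Definition gradient f (x : 'cV[R]_n) : 'cV[R]_n :=
  \col_i 'D_(delta_mx i ord0) f x.

Definition C1_open U g :=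
  open U /\
  forall x, U x -> differentiable g x /\ {for x, continuous (gradient g)}.

(* A function on X is a total function whose values outside X are irrelevant. *)
Definition C1_on X f := exists U g,
  [/\ C1_open U g, X `<=` U & {in X, f =1 g}].

(* The continuous extension to X of the gradient of f on the interior of X; it
   only depends on the values of f on X. *)
Definition gradient_on X f (x : 'cV[R]_n) : 'cV[R]_n :=
  lim (gradient f y @[y --> within X° (nbhs x)]).

Definition differential_on X f (x v : 'cV[R]_n) : R :=
  (v^T *m gradient_on X f x) ord0 ord0.

Lemma gradient_onE X f U g : regular_closed X ->
  C1_open U g -> X `<=` U -> {in X, f =1 g} ->
  {in X, gradient_on X f =1 gradient g}.
Proof.
move=> rX [oU C1g] XU fg x; rewrite inE => Xx.
have FF : ProperFilter (within X° (nbhs x)).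
  by apply: within_nbhs_proper; rewrite /infer -rX.
apply: cvg_lim; first exact: (@norm_hausdorff R 'cV[R]_n).
have gc : gradient g y @[y --> within X° (nbhs x)] --> gradient g x.
  apply: cvg_trans (C1g x (XU _ Xx)).2.
  by apply: cvg_app; exact: cvg_within.
apply: cvg_trans gc; apply: near_eq_cvg.
rewrite near_withinE; near=> y => Xy.
apply/colP => i; rewrite !mxE; apply/esym.
apply: near_eq_derive.
have yX : nbhs y X := Xy.
by apply: filterS yX => z Xz; rewrite fg// inE.
Unshelve. all: by end_near. Qed.

End gradient.

Definition gradient_covariance (R : realType) (n : nat) (X : set 'cV[R]_n)
    (f rho : 'cV[R]_n -> R) : 'M[R]_n :=
  \matrix_(i, j) \int[lebesgue_cV R n]_(x in X)
    ((gradient_on X f x *m (gradient_on X f x)^T) i j * rho x).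

Definition probability_density (R : realType) (n : nat) (X : set 'cV[R]_n)
    (rho : 'cV[R]_n -> R) :=
  [/\ measurable_fun (X : set (lebesgueType R n)) rho,
      forall x, X x -> 0 <= rho x
    & (\int[lebesgue_cV R n]_(x in X) (rho x)%:E = 1)%E].

Definition full_support (R : realType) (n : nat) (X : set 'cV[R]_n)
    (rho : 'cV[R]_n -> R) :=
  forall U : set 'cV[R]_n, open U -> X `&` U !=set0 ->
    (0 < \int[lebesgue_cV R n]_(x in X `&` U) (rho x)%:E)%E.

(* The span of the columns w_{r+1}, ..., w_n of W, which have indices
   r, ..., n - 1 in 'I_n. *)
Definition trailing_space (R : realType) (n r : nat) (W : 'M[R]_n) :
    {vspace 'cV[R]_n} :=
  <<[seq col i W | i : 'I_n <- enum 'I_n & (r <= i)%N]>>%VS.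

(* Main.v *)
(* For every v, v^T C v is the integral of (df_x[v])^2 rho(x). As
   lambda_i = w_i^T C w_i, lambda_i vanishes exactly when df_x[w_i] vanishes
   rho-almost everywhere on X, and then everywhere on X, because df_x[w_i] is
   continuous in x and rho has full support. A function with df_x[v] = 0 on a
   segment of direction v is constant along it by the mean value theorem;
   conversely, invariance along short segments kills the derivative in the
   interior of X, hence, by continuity, on X = closure (int X).
   Integrating continuous functions requires that open sets be Caratheodory
   measurable for the outer measure built from boxes. *)
Require Import Defs.
From HB Require Import structures.
From mathcomp Require Import all_boot all_order all_algebra.
From mathcomp Require Import all_classical all_reals all_analysis.
From mathcomp Require Import measurable_realfun.

Set Implicit Arguments.
Unset Strict Implicit.
Unset Printing Implicit Defensive.

Import Order.TTheory GRing.Theory Num.Theory.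
Import numFieldNormedType.Exports.

Local Open Scope classical_set_scope.
Local Open Scope ring_scope.

(** * Lebesgue measurability of topological sets and integrability of continuous multiples of the
    density *)

Section measurability.
Context (R : realType) (n : nat).
Implicit Types (A U X : set 'cV[R]_n) (c : option ('cV[R]_n * 'cV[R]_n)).

(** Cutting along x_i = t keeps boxes half-open, so the two pieces are disjoint boxes. A piece may
    get an upper bound below its lower bound; it is then empty, and the truncation at 0 in
    [box_volume] gives it volume 0. *)
Definition box_le (i : 'I_n) (t : R) c :=
  if c is Some (a, b) then
    Some (a, \col_k if k == i then Num.min (b k ord0) t else b k ord0)
  else None.

Definition box_gt (i : 'I_n) (t : R) c :=
  if c is Some (a, b) then
    Some (\col_k if k == i then Num.max (a k ord0) t else a k ord0, b)
  else None.

Lemma box_leE i t c : box (box_le i t c) = box c `&` [set x | x i ord0 <= t].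
Proof.
case: c => [[a b]|] /=; last by rewrite set0I.
apply/seteqP; split => x /=.
- move=> H; split.
    move=> k; have := H k; rewrite mxE; case: eqP => // ->.
    by rewrite le_min => /and3P[-> ->].
  by have := H i; rewrite mxE eqxx le_min => /and3P[].
- move=> [H xt] k; rewrite mxE; case: eqP => [->|_]; last exact: H.
  by rewrite le_min xt andbT H.
Qed.

Lemma box_gtE i t c : box (box_gt i t c) = box c `\` [set x | x i ord0 <= t].
Proof.
case: c => [[a b]|] /=; last by rewrite set0D.
apply/seteqP; split => x /=.
- move=> H; split.
    move=> k; have := H k; rewrite mxE; case: eqP => // ->.
    by rewrite gt_max => /andP[/andP[-> _] ->].
  have := H i; rewrite mxE eqxx gt_max => /andP[/andP[_ tx] _].
  by apply/negP; rewrite -ltNge.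
- move=> [H /= /negP]; rewrite -ltNge => xt k; rewrite mxE.
  case: eqP => [->|_]; last exact: H.
  by rewrite gt_max xt andbT H.
Qed.

(** Only the side in direction [i] changes, so the product of the other sides factors out and the
    claim reduces to additivity of truncated lengths on the line. *)
Lemma box_volume_cut i t c :
  box_volume (box_le i t c) + box_volume (box_gt i t c) = box_volume c.
Proof.
case: c => [[a b]|] /=; last by rewrite addr0.
pose side (a' b' : 'cV[R]_n) k := Num.max 0 (b' k ord0 - a' k ord0).
have volE a' b' : (forall k, k != i -> side a' b' k = side a b k) ->
    \prod_k side a' b' k = side a' b' i * \prod_(k | k != i) side a b k.
  by move=> ab; rewrite (bigD1 i)//=; congr (_ * _); exact: eq_bigr.
rewrite !(volE a, volE _ b)//; last first.
  by move=> k /negbTE ki; rewrite /side !mxE ki.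
  by move=> k /negbTE ki; rewrite /side !mxE ki.
rewrite -mulrDl; congr (_ * _); rewrite /side !mxE eqxx.
move: (a i ord0) (b i ord0) => u v.
(* Three positions of the cut: above [v] the upper piece is empty, below [u] the lower one is, and
   in between the two lengths telescope. *)
have [vt|/ltW tv] := leP v t.
  by rewrite (@max_l _ _ 0 (v - Num.max u t)) ?addr0// subr_le0 le_max vt orbT.
have [ut|tu] := leP u t; last first.
  by rewrite (@max_l _ _ 0 (t - u)) ?add0r// subr_le0 ltW.
have uv := le_trans ut tv.
by rewrite !max_r ?subr_ge0// addrC subrKA.
Qed.

Lemma box_volume_ge0 c : 0 <= box_volume c.
Proof.
case: c => [[a b]|] //=.
by apply: prodr_ge0 => i _; rewrite le_max lexx.
Qed.

(* Cutting each box of a cover along the hyperplane x_i = t yields covers of the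
   two halves whose total volumes add up to that of the original cover. *)
Lemma measurable_halfspace i t :
  measurable ([set x | x i ord0 <= t] : set (lebesgueType R n)).
Proof.
apply: le_caratheodory_measurable => A.
apply: le_ereal_inf_tmp => _ [c Ac <-].
have -> : (\sum_(k <oo) (box_volume (c k))%:E =
  \sum_(k <oo) (box_volume (box_le i t (c k)))%:E +
  \sum_(k <oo) (box_volume (box_gt i t (c k)))%:E)%E.
  rewrite -nneseriesD => [|k _ _|k _ _]; try by rewrite lee_fin box_volume_ge0.
  by apply: eq_eseriesr => k _; rewrite -EFinD box_volume_cut.
apply: leeD; apply: ereal_inf_lbound.
- exists (fun k => box_le i t (c k)) => //= x [/Ac[k _ ckx] xt].
  by exists k => //; rewrite box_leE.
- exists (fun k => box_gt i t (c k)) => //= x [/Ac[k _ ckx] xt].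
  by exists k => //; rewrite box_gtE.
Qed.

Lemma measurable_coord i :
  measurable_fun setT (fun x : lebesgueType R n => (x : 'cV[R]_n) i ord0).
Proof.
apply: (measurability _ (RGenOInfty.measurableE R)) => _ [_ [x ->] <-].
rewrite setTI [X in measurable X]
  (_ : _ = ~` [set y : 'cV[R]_n | y i ord0 <= x]).
  exact/measurableC/measurable_halfspace.
apply/seteqP; split => y /=; rewrite in_itv/= andbT => h.
- by apply/negP; rewrite -ltNge.
- by rewrite ltNge; exact/negP.
Qed.

(** Balls are those of the sup norm, hence finite intersections of coordinate slabs. *)
Lemma lebesgue_measurable_ball (x : 'cV[R]_n) e : 0 < e ->
  measurable (ball x e : set (lebesgueType R n)).
Proof.
move=> e0; rewrite (_ : ball x e = \bigcap_(i in [set: 'I_n])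
  ((fun y : lebesgueType R n => (y : 'cV[R]_n) i ord0) @^-1`
     ball (x i ord0) e)).
  apply: fin_bigcap_measurable => // i _; rewrite -[X in measurable X]setTI.
  apply: measurable_coord => //; exact: measurable_ball.
apply/seteqP; split => [y [_ yx] i _|y yx]; first exact: yx.
by split => // i j; rewrite ord1; exact: yx.
Qed.

(** An open set is the union of the balls it contains with rational centre and radius 1/(N+1), a
    countable family. *)
Lemma lebesgue_measurable_open U :
  open U -> measurable (U : set (lebesgueType R n)).
Proof.
move=> oU.
pose r (q : 'cV[rat]_n) : 'cV[R]_n := map_mx ratr q.
pose D := [set p : 'cV[rat]_n * nat | ball (r p.1) p.2.+1%:R^-1 `<=` U].
rewrite (_ : U = \bigcup_(p in D) ball (r p.1) p.2.+1%:R^-1).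
  rewrite bigcup_mkcond; apply: countable_bigcupT_measurable => // p.
  by case: ifPn => _; [exact: lebesgue_measurable_ball|exact: measurable0].
apply/seteqP; split => [x Ux|x [p Dp]]; last exact: Dp.
have /nbhs_ballP[e /= e0 xeU] := open_nbhs_nbhs (conj oU Ux).
(* A rational centre within 1/(N+1) < e/2 of [x] gives a ball that contains [x] and, by the triangle
   inequality, stays in the [e]-ball around [x]. *)
have e20 : 0 < e / 2 by rewrite divr_gt0.
have [N _ /(_ N (leqnn N)) Ne] := near_infty_natSinv_lt (PosNum e20).
have q_ i : exists q : rat, `|x i ord0 - ratr q| < N.+1%:R^-1.
  have [|q] := @rat_in_itvoo R (x i ord0 - N.+1%:R^-1) (x i ord0 + N.+1%:R^-1).
    by rewrite ltrD2l gtrN.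
  rewrite in_itv/= => /andP[q1 q2]; exists q.
  by rewrite ltr_distlC q1 q2.
have [q xq] := choice q_.
exists (\col_i q i, N) => /= [y [_ qy]|]; last first.
  by split => // i j; rewrite !mxE ord1; apply: ball_sym; exact: xq.
apply: xeU; split => // i j; rewrite [e]splitr.
rewrite ord1; apply: (@ball_triangle R R (ratr (q i))).
  by apply: (@le_ball R R _ _ _ (ltW Ne)); exact: xq.
apply: (@le_ball R R _ _ _ (ltW Ne)).
by have := qy i ord0; rewrite !mxE.
Qed.

Lemma lebesgue_measurable_closed A :
  closed A -> measurable (A : set (lebesgueType R n)).
Proof.
move=> cA; rewrite -[A]setCK; apply/measurableC/lebesgue_measurable_open.
exact: closed_openC.
Qed.

Lemma lebesgue_measurable_compact A :
  compact A -> measurable (A : set (lebesgueType R n)).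
Proof.
move=> cA; apply: lebesgue_measurable_closed.
exact: compact_closed (@norm_hausdorff R 'cV[R]_n) cA.
Qed.

Lemma lebesgue_measurable_continuous X (k : 'cV[R]_n -> R) :
  {within X, continuous k} -> measurable_fun (X : set (lebesgueType R n)) k.
Proof.
move=> ck mX; apply: (measurability _ (RGenOInfty.measurableE R)) => //.
move=> _ [_ [x ->] <-].
have : open ((k : subspace X -> R) @^-1` `]x, +oo[%classic).
  by apply: open_comp => [y _|]; [exact: ck|exact: interval_open].
move=> /open_subspaceP[U oU UX].
rewrite setIC -UX setIC; apply: measurableI => //.
exact: lebesgue_measurable_open.
Qed.

(** By compactness [k] is bounded on [X] by some [M], so the product is dominated by [M * rho]. *)
Lemma integrableM_continuous X (k rho : 'cV[R]_n -> R) : compact X ->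
  {within X, continuous k} ->
  (lebesgue_cV R n).-integrable X (EFin \o rho) ->
  (lebesgue_cV R n).-integrable X (fun x => (k x * rho x)%:E).
Proof.
move=> cX ck irho.
have mX : measurable (X : set (lebesgueType R n)).
  exact: lebesgue_measurable_compact.
have [M M0 kM] : exists2 M : R, 0 < M & forall x, X x -> `|k x| <= M.
  have /compact_bounded/ex_strict_bound_gt0[M M0 kM] : compact (k @` X).
    exact: continuous_compact.
  by exists M => // x Xx; apply/ltW/kM; exists x.
have mrho : measurable_fun (X : set (lebesgueType R n)) rho.
  by have /integrableP[/measurable_EFinP] := irho.
apply: (@le_integrable _ _ _ _ _ mX _ (fun x => M%:E * (rho x)%:E)%E).
- apply/measurable_EFinP/measurable_funM => //.
  exact: lebesgue_measurable_continuous.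
- move=> x Xx; rewrite -EFinM lee_fin !normrM (gtr0_norm M0).
  by rewrite ler_wpM2r// kM.
- exact: integrableZl.
Qed.

End measurability.

(** * Directional derivatives and invariance along segments *)

Section gradient.
Context (R : realType) (n : nat).
Implicit Types (X U : set 'cV[R]_n) (f g : 'cV[R]_n -> R) (x v : 'cV[R]_n).

Lemma derive_gradient g x v : differentiable g x ->
  'D_v g x = (v^T *m gradient g x) ord0 ord0.
Proof.
move=> dg; rewrite deriveE// [v in LHS]matrix_sum_delta linear_sum mxE.
apply: eq_bigr => i _; rewrite linear_sum big_ord1 linearZ/= -deriveE//.
by rewrite !mxE.
Qed.

Lemma is_derive_line g x v (t : R) : differentiable g (x + t *: v) ->
  is_derive t 1 (fun s : R => g (x + s *: v))
    ((v^T *m gradient g (x + t *: v)) ord0 ord0).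
Proof.
move=> dg; rewrite -derive_gradient//.
have shift :
    (fun h : R =>
       h^-1 *: (g (x + (h *: (1 : R) + t) *: v) - g (x + t *: v))) = (fun h => h^-1 *: (g (h *: v + (x + t *: v)) - g (x + t *: v))).
  apply/funext => h; congr (_ *: (g _ - _)).
  by rewrite [h *: _]mulr1 scalerDl addrCA.
have dgv : derivable g (x + t *: v) v by exact: diff_derivable.
apply: DeriveDef; first by rewrite /derivable /shift/= shift.
by rewrite /derive /shift/= shift.
Qed.

Lemma continuous_gradient_dot U g v x : C1_open U g -> U x ->
  {for x, continuous (fun y => (v^T *m gradient g y) ord0 ord0)}.
Proof.
move=> [_ C1g] Ux.
have gc := (C1g x Ux).2.
have dotc : continuous (fun M : 'cV[R]_n => (v^T *m M) ord0 ord0).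
  rewrite (_ : (fun M => _) = (fun M : 'cV_n => \sum_i v i ord0 * M i ord0)).
    apply: continuous_big => [|i _ M]; first exact: add_continuous.
    by apply: (cvgMl_tmp (F := nbhs M)); exact: coord_continuous.
  by apply/funext => M; rewrite mxE; apply: eq_bigr => i _; rewrite !mxE.
exact: (continuous_comp gc (dotc _)).
Qed.

Lemma differential_onE X f U g v : regular_closed X ->
  C1_open U g -> X `<=` U -> {in X, f =1 g} ->
  {in X, (fun x => differential_on X f x v) =1
         (fun x => (v^T *m gradient g x) ord0 ord0)}.
Proof.
move=> rX C1g XU fg x Xx.
by rewrite /differential_on (gradient_onE rX C1g XU fg).
Qed.

Lemma continuous_differential_on X f v : regular_closed X -> C1_on X f ->
  {within X, continuous (fun x => differential_on X f x v)}.
Proof.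
move=> rX [U [g [C1g XU fg]]].
apply: (@subspace_eq_continuous _ _ _
  (fun x => (v^T *m gradient g x) ord0 ord0)).
  by move=> x Xx; apply/esym; exact: (differential_onE v rX C1g XU fg).
apply: continuous_in_subspaceT => x; rewrite inE => /XU.
exact: continuous_gradient_dot.
Qed.

(** The mean value theorem is applied to the extension [g], not to [f]: the segment may run along
    the boundary of [X], where only [g] is known to be differentiable. *)
Lemma differential_vanishes_invariant X f v : regular_closed X -> C1_on X f ->
  (forall x, X x -> differential_on X f x v = 0) ->
  forall x, (forall t : R, 0 <= t <= 1 -> X (x + t *: v)) -> f (x + v) = f x.
Proof.
move=> rX [U [g [C1g XU fg]]] df0 x Xxv.
have dphi (t : R) : 0 <= t <= 1 ->
    is_derive t 1 (fun s : R => g (x + s *: v)) 0.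
  move=> t01; have Xt := Xxv t t01.
  rewrite -(df0 _ Xt) (differential_onE _ rX C1g XU fg) ?inE//.
  by apply: is_derive_line; exact: (C1g.2 _ (XU _ Xt)).1.
have [||c _] := @MVT_segment R (fun s : R => g (x + s *: v)) (fun=> 0) 0 1 ler01.
- move=> t; rewrite in_itv/= => /andP[t0 t1].
  by apply: dphi; rewrite !ltW.
- apply: continuous_in_subspaceT => t; rewrite inE/= in_itv/= => t01.
  apply: differentiable_continuous; apply/derivable1_diffP.
  by have [] := dphi t t01.
rewrite mul0r scale1r scale0r addr0 => /eqP; rewrite subr_eq0 => /eqP gxv.
rewrite !fg// inE.
  by rewrite -[x]addr0 -(scale0r v); apply: Xxv; rewrite lexx ler01.
by rewrite -[X in x + X]scale1r; apply: Xxv; rewrite lexx ler01.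
Qed.

(** Invariance is assumed for all multiples [s *: v], because the segment from [x] to [x + v] may
    leave [X] while short ones from an interior point do not. *)
Lemma invariant_differential_vanishes X f v : regular_closed X -> C1_on X f ->
  (forall (s : R) x, X x ->
    (forall t : R, 0 <= t <= 1 -> X (x + t *: (s *: v))) ->
    f (x + s *: v) = f x) ->
  forall x, X x -> differential_on X f x v = 0.
Proof.
move=> rX [U [g [C1g XU fg]]] inv.
have int0 x : X° x -> (v^T *m gradient g x) ord0 ord0 = 0.
  move=> Xx; have XX := @interior_subset _ X.
  have dg : differentiable g (x + 0 *: v).
    by rewrite scale0r addr0; exact: (C1g.2 x (XU _ (XX _ Xx))).1.
  have := is_derive_line dg; rewrite scale0r addr0 => -[_ <-].
  (* For small [s] the whole segment from [x] to [x + s *: v] lies in a ball inside [X], so [g]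
     along the line equals [g x] near 0. *)
  transitivity ('D_1 (cst (g x)) (0 : R)); last by rewrite derive_cst.
  apply: near_eq_derive.
  have /nbhs_ballP[e /= e0 xeX] : nbhs x X := Xx.
  have line0 : (s *: v) @[s --> (0 : R)] --> (0 : 'cV[R]_n).
    rewrite -[X in _ --> X](scale0r v).
    by apply: cvgZr_tmp; exact: cvg_id.
  have : \forall s \near (0 : R), ball (0 : 'cV[R]_n) e (s *: v).
    by apply: line0; exact: nbhsx_ballx.
  apply: filterS => s vs.
  have segm (t : R) : 0 <= t <= 1 -> X (x + t *: (s *: v)).
    move=> /andP[t0 t1]; apply: xeX; move: vs; rewrite -!ball_normE/=.
    rewrite sub0r normrN opprD addrA subrr sub0r normrN => vs.
    by rewrite normrZ (le_lt_trans _ vs)// ler_piMl// ger0_norm.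
  have Xs : X (x + s *: v).
    by rewrite -[s *: v]scale1r; apply: segm; rewrite lexx ler01.
  by rewrite -!fg ?inE ?inv//; exact: XX.
move=> x Xx; rewrite (differential_onE _ rX C1g XU fg) ?inE//.
(* A nonzero derivative at [x] would persist on a neighbourhood of [x], which meets the interior of
   [X], where it vanishes. *)
apply: contrapT => /eqP dgx0.
have gc := continuous_gradient_dot (v:=v) C1g (XU _ Xx).
have : X x := Xx; rewrite {1}rX => clx.
have /clx[y [Xy /eqP]] : nbhs x [set y | (v^T *m gradient g y) ord0 ord0 != 0].
  exact: (gc _ (open_nbhs_nbhs (conj (@open_neq R 0) dgx0))).
by apply; exact: int0.
Qed.

End gradient.

(** * The quadratic form of the covariance and the use of full support *)

Section covariance.
Context (R : realType) (n : nat).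
Implicit Types (X : set 'cV[R]_n) (f rho : 'cV[R]_n -> R) (v : 'cV[R]_n).

Lemma density_integrable X rho : compact X -> probability_density X rho ->
  (lebesgue_cV R n).-integrable X (EFin \o rho).
Proof.
move=> cX [mrho rho0 rho1]; have mX := lebesgue_measurable_compact cX.
apply/integrableP; split; first exact/measurable_EFinP.
rewrite (_ : integral _ _ _ = 1%E) ?ltry// -rho1.
by apply: eq_integral => x; rewrite inE => Xx; rewrite /= ger0_norm// rho0.
Qed.

(** If [k x > 0], then [k] exceeds [e = k x / 2] on a nonempty relatively open part of [X]; this
    part has positive mass, so the integral would be positive. *)
Lemma full_support_integral_eq0 X (k : 'cV[R]_n -> R) rho : compact X ->
  probability_density X rho -> full_support X rho ->
  {within X, continuous k} -> (forall x, X x -> 0 <= k x) ->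
  (\int[lebesgue_cV R n]_(x in X) (k x * rho x)%:E = 0)%E ->
  forall x, X x -> k x = 0.
Proof.
move=> cX drho srho ck k0 intk0 x Xx.
have mX := lebesgue_measurable_compact cX.
have [mrho rho0 _] := drho.
have ikrho := integrableM_continuous cX ck (density_integrable cX drho).
have mkrho : measurable_fun (X : set (lebesgueType R n))
    (fun x => (k x * rho x)%:E).
  exact: measurable_int ikrho.
apply/eqP; rewrite eq_le k0// andbT leNgt; apply/negP => kx0.
pose e := k x / 2.
have e0 : 0 < e by rewrite divr_gt0.
have : open ((k : subspace X -> R) @^-1` `]e, +oo[%classic).
  by apply: open_comp => [y _|]; [exact: ck|exact: interval_open].
move=> /open_subspaceP[U oU UX].
have XU0 : X `&` U !=set0.
  exists x; split => //.
  have : (((k : subspace X -> R) @^-1` `]e, +oo[%classic) `&` X) x.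
    by split => //=; rewrite in_itv/= andbT /e gtr_pMr// invf_lt1// ltr1n.
  by rewrite -UX => -[].
have mXU : measurable (X `&` U : set (lebesgueType R n)).
  by apply: measurableI => //; exact: lebesgue_measurable_open.
have XUX : X `&` U `<=` X by exact: subIsetl.
have mrhoU := measurable_funS mX XUX (mrho : measurable_fun _ _).
have := srho U oU XU0; apply/negP; rewrite -leNgt.
(* The mass of [X] within [U], times [e], is at most the integral of [k * rho] over that part, hence
   over [X], which is 0. *)
rewrite -(@pmule_rle0 _ e%:E) ?lte_fin//.
rewrite -ge0_integralZl//; last 3 first.
- exact/measurable_EFinP.
- by move=> y [Xy _]; rewrite lee_fin rho0.
- by rewrite lee_fin ltW.
rewrite -intk0.
apply: le_trans (ge0_subset_integral _ mXU mX mkrho _ XUX); last first.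
  by move=> y Xy; rewrite lee_fin mulr_ge0// ?k0// rho0.
apply: ge0_le_integral => //.
- by move=> y [Xy _]; rewrite mule_ge0// lee_fin ?rho0// ltW.
- by apply: measurable_funeM; exact/measurable_EFinP.
- exact: measurable_funS mX XUX mkrho.
move=> y [Xy Uy]; rewrite -EFinM lee_fin ler_wpM2r ?rho0//.
have : (U `&` X) y by [].
by rewrite UX => -[/=]; rewrite in_itv/= andbT => /ltW.
Qed.

(** Both sides expand into the same sum over pairs of indices, and integrability of each entry lets
    the finite sum leave the integral. *)
Lemma gradient_covariance_form X f rho v : compact X -> regular_closed X ->
  C1_on X f -> probability_density X rho ->
  (\int[lebesgue_cV R n]_(x in X) (differential_on X f x v ^+ 2 * rho x)%:E =
   ((v^T *m gradient_covariance X f rho *m v) ord0 ord0)%:E)%E.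
Proof.
move=> cX rX C1f drho; have mX := lebesgue_measurable_compact cX.
pose h x := gradient_on X f x.
have hE i x : h x i ord0 = differential_on X f x (delta_mx i ord0).
  by rewrite /differential_on trmx_delta -rowE mxE.
have ih i j : (lebesgue_cV R n).-integrable X
    (fun x => (((h x *m (h x)^T) i j) * rho x)%:E).
  apply: (integrableM_continuous cX _ (density_integrable cX drho)).
  (* Each entry is a product of derivatives along basis vectors, which are continuous on [X]. *)
  rewrite (_ : (fun x => _) = (fun x =>
      differential_on X f x (delta_mx i ord0) *
      differential_on X f x (delta_mx j ord0))).
    by move=> x; apply: cvgM; exact: (continuous_differential_on rX C1f).
  by apply/funext => x; rewrite mxE big_ord1 mxE !hE.
have vC : (v^T *m gradient_covariance X f rho *m v) ord0 ord0 =
    \sum_(p : 'I_n * 'I_n) v p.1 ord0 * v p.2 ord0 *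
      gradient_covariance X f rho p.1 p.2.
  rewrite mxE -(pair_bigA _ (fun i j => v i ord0 * v j ord0 *
    gradient_covariance X f rho i j))/= exchange_big/=.
  apply: eq_bigr => j _; rewrite mxE mulr_suml; apply: eq_bigr => i _.
  by rewrite mxE mulrAC.
have dE x : differential_on X f x v ^+ 2 * rho x =
    \sum_(p : 'I_n * 'I_n) v p.1 ord0 * v p.2 ord0 *
      ((h x *m (h x)^T) p.1 p.2 * rho x).
  rewrite -(pair_bigA _ (fun i j => v i ord0 * v j ord0 *
    ((h x *m (h x)^T) i j * rho x)))/=.
  rewrite expr2 {1 2}/differential_on mxE mulr_suml mulr_suml.
  apply: eq_bigr => i _; rewrite mulr_sumr mulr_suml.
  apply: eq_bigr => j _; rewrite !mxE big_ord1 !mxE -mulrA.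
  by rewrite !mulrA; congr (_ * _ * _); rewrite mulrAC.
under eq_integral do rewrite dE -sumEFin.
rewrite integral_sum//; last first.
  by move=> p; under eq_fun do rewrite EFinM; exact: integrableZl.
rewrite vC -sumEFin; apply: eq_bigr => p _.
under eq_integral do rewrite EFinM.
rewrite integralZl// [RHS]EFinM; congr (_ * _)%E.
(* The covariance entries are real-valued integrals; finiteness ensures that passing to the reals
   loses nothing. *)
by rewrite mxE fineK//; exact: integrable_fin_num.
Qed.

End covariance.

(** * Eigenvalues, derivatives and invariance on the trailing space *)

Theorem proposition1 (R : realType) (n r : nat) (X : set 'cV[R]_n)
    (f rho : 'cV[R]_n -> R) (W : 'M[R]_n) (lambda : 'rV[R]_n)
    (compactX : compact X) (regularX : regular_closed X)
    (C1f : C1_on X f)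
    (density_rho : probability_density X rho)
    (support_rho : full_support X rho)
    (orthogonalW : W^T *m W = 1%:M)
    (decomposition :
      gradient_covariance X f rho = W *m diag_mx lambda *m W^T)
    (sorted_lambda : forall i j : 'I_n,
      (i <= j)%N -> lambda ord0 j <= lambda ord0 i)
    (lambda_ge0 : forall i : 'I_n, 0 <= lambda ord0 i)
    (r_ge1 : (1 <= r)%N) (r_len : (r <= n)%N) :
  let eigenvalues_vanish :=
    forall i : 'I_n, (r <= i)%N -> lambda ord0 i = 0 in
  let differential_vanishes :=
    forall x v : 'cV[R]_n, X x -> v \in trailing_space r W ->
      differential_on X f x v = 0 in
  let invariant :=
    forall x v : 'cV[R]_n, X x -> v \in trailing_space r W ->
      (forall t : R, 0 <= t <= 1 -> X (x + t *: v)) -> f (x + v) = f x in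
  (eigenvalues_vanish <-> differential_vanishes) /\
  (differential_vanishes <-> invariant).
Proof.
move=> eigenvalues_vanish differential_vanishes invariant.
have formW (i : 'I_n) :
    ((col i W)^T *m gradient_covariance X f rho *m col i W) ord0 ord0 =
    lambda ord0 i.
  rewrite decomposition !mulmxA -!mulmxA colE trmx_mul !mulmxA.
  rewrite -(mulmxA _ W^T W) orthogonalW mulmx1.
  rewrite -(mulmxA _ W^T W) orthogonalW mulmx1.
  by rewrite trmx_delta -rowE -colE !mxE eqxx.
have colW (i : 'I_n) : (r <= i)%N -> col i W \in trailing_space r W.
  move=> ri; apply/memv_span/mapP; exists i => //.
  by rewrite mem_filter ri mem_enum.
split; split.
- move=> lambda0 x v Xx; rewrite /trailing_space.
  (* The differential is linear in the direction, so it suffices to treat the spanning columns. *)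
  set s := [seq _ | _ <- _ & _]; move=> /(@coord_span _ _ _ (in_tuple s)) ->.
  rewrite /differential_on linear_sum/= mulmx_suml summxE big1// => k _.
  rewrite linearZ/= -scalemxAl mxE.
  set w := nth _ _ _.
  suff w0 : differential_on X f x w = 0 by rewrite [X in _ * X]w0 mulr0.
  have /mapP[i] : w \in s by exact: mem_nth.
  rewrite mem_filter => /andP[ri _] ->.
  apply/eqP; rewrite -sqrf_eq0; apply/eqP.
  apply: (full_support_integral_eq0 compactX density_rho support_rho
    (k := fun x => differential_on X f x (col i W) ^+ 2)) => //.
  + move=> y; apply: cvgM; exact: (continuous_differential_on regularX C1f).
  + by move=> y _; exact: sqr_ge0.
  + by rewrite gradient_covariance_form// formW lambda0.
(* Here the eigenvalue is the integral of a square that vanishes on all of [X]. *)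
- move=> df0 i ri; apply: EFin_inj.
  rewrite -formW -gradient_covariance_form//.
  apply: integral0_eq => x Xx.
  by rewrite df0 ?expr0n ?mul0r//; exact: colW.
- move=> df0 x v Xx vS; apply: (differential_vanishes_invariant regularX C1f).
  by move=> y Xy; exact: df0.
(* The trailing space is closed under scaling, which supplies the short segments. *)
- move=> inv x v Xx vS.
  apply: (invariant_differential_vanishes regularX C1f) => //.
  by move=> s y Xy; apply: inv => //; exact: memvZ.
Qed.
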